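(* Let $I_m$ denote the path graph on $m$ vertices and $\square$ the Cartesian product of graphs. If $m\geq 3$, then the graph $I_m\,\square\, I_2$ has trivial bold homology, i.e. $\mathbb H^j(I_m\,\square\, I_2)=0$ for all $j$.
   Context: For a finite connected simple graph $G$, regarded as a $1$-dimensional simplicial complex, and $S\subseteq V(G)$ let $G[S]$ be the subgraph induced by $S$ (with $G[\emptyset]=\emptyset$, which has zero homology). The bold homology $\mathbb H^*(G)$ (with integer coefficients) is the homology of the cochain complex whose $j$-th module is $\bigoplus_{S\subseteq V(G),\,|S|=j}\mathrm H_0(G[S];\mathbb Z)$ and whose differential has components, for $v\notin S$, $(-1)^{\#\{w\in S:\,w<v\}}$ times the map $\mathrm H_0(G[S];\mathbb Z)\to\mathrm H_0(G[S\cup\{v\}];\mathbb Z)$ induced by inclusion, for a fixed order of the vertices. *)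

(* Defs.v *)
From HB Require Import structures.
From mathcomp Require Import all_boot all_order all_algebra.
From mathcomp Require Import boolp.

Set Implicit Arguments.
Unset Strict Implicit.
Unset Printing Implicit Defensive.

Import GRing.Theory.
Local Open Scope ring_scope.
Local Open Scope quotient_scope.

Section DirectSum.
Variables (I : finType) (M : I -> zmodType).

Record dsum := DSum { dsum_ffun : {dffun forall i : I, M i} }.

HB.instance Definition _ := [isNew for dsum_ffun].
HB.instance Definition _ := [Choice of dsum by <:].

Definition dsum_proj (x : dsum) (i : I) : M i := dsum_ffun x i.
Coercion dsum_proj : dsum >-> Funclass.

Definition dsum_of (f : forall i, M i) : dsum := DSum [ffun i => f i].

Lemma dsum_ofE f i : dsum_of f i = f i.
Proof. exact: ffunE. Qed.

Lemma dsumP (x y : dsum) : (forall i, x i = y i) <-> x = y.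
Proof. by split=> [xy|-> //]; apply/val_inj/ffunP. Qed.

Let dsum_zero := dsum_of (fun i => 0).
Let dsum_opp (x : dsum) := dsum_of (fun i => - x i).
Let dsum_add (x y : dsum) := dsum_of (fun i => x i + y i).

Let dsum_addA : associative dsum_add.
Proof. by move=> x y z; apply/dsumP => i; rewrite !dsum_ofE addrA. Qed.
Let dsum_addC : commutative dsum_add.
Proof. by move=> x y; apply/dsumP => i; rewrite !dsum_ofE addrC. Qed.
Let dsum_add0 : left_id dsum_zero dsum_add.
Proof. by move=> x; apply/dsumP => i; rewrite !dsum_ofE add0r. Qed.
Let dsum_addN : left_inverse dsum_zero dsum_opp dsum_add.
Proof. by move=> x; apply/dsumP => i; rewrite !dsum_ofE addNr. Qed.

HB.instance Definition _ :=
  GRing.isZmodule.Build dsum dsum_addA dsum_addC dsum_add0 dsum_addN.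

Lemma dsum0E i : (0 : dsum) i = 0. Proof. exact: dsum_ofE. Qed.
Lemma dsumNE (x : dsum) i : (- x) i = - x i. Proof. exact: dsum_ofE. Qed.
Lemma dsumDE (x y : dsum) i : (x + y) i = x i + y i.
Proof. exact: dsum_ofE. Qed.
Lemma dsumBE (x y : dsum) i : (x - y) i = x i - y i.
Proof. by rewrite dsumDE dsumNE. Qed.

End DirectSum.

Section ImageKernelCokernel.
Variables (A B : zmodType) (f : {additive A -> B}).

Definition im : {pred B} := [pred y | `[< exists x, y = f x >]].

Lemma imP y : reflect (exists x, y = f x) (y \in im).
Proof. exact: asboolP. Qed.

Lemma im_zmod_closed : zmod_closed im.
Proof.
split=> [|_ _ /imP[x ->] /imP[y ->]]; apply/imP.
  by exists 0; rewrite raddf0.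
by exists (x - y); rewrite raddfB.
Qed.
HB.instance Definition _ := GRing.isZmodClosed.Build B im im_zmod_closed.

Definition coker : zmodType := Quotient.quot im.

Definition ker : {pred A} := [pred x | f x == 0].

Lemma ker_zmod_closed : zmod_closed ker.
Proof.
split=> [|x y]; rewrite !inE ?raddf0 // => /eqP fx /eqP fy.
by rewrite raddfB fx fy subrr.
Qed.
HB.instance Definition _ := GRing.isZmodClosed.Build A ker ker_zmod_closed.

Definition kernel : Type := {x : A | x \in ker}.
HB.instance Definition _ := SubChoice.on kernel.
HB.instance Definition _ := [SubChoice_isSubZmodule of kernel by <:].

End ImageKernelCokernel.

Record sgraph := SGraph {
  vertex :> finType;
  adj : rel vertex;
  adj_sym : symmetric adj;
  adj_irr : irreflexive adj
}.

Section PathGraph.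
Variable m : nat.
Let e : rel 'I_m := fun i j => (i.+1 == j :> nat) || (j.+1 == i :> nat).

Let e_sym : symmetric e. Proof. by move=> i j; rewrite /e orbC. Qed.
Let e_irr : irreflexive e. Proof. by move=> i; rewrite /e orbb gtn_eqF. Qed.

Definition path_graph : sgraph := SGraph e_sym e_irr.
End PathGraph.

Section CartesianProduct.
Variables G H : sgraph.
Let e : rel (G * H)%type := fun p q =>
  ((p.1 == q.1) && adj p.2 q.2) || ((p.2 == q.2) && adj p.1 q.1).

Let e_sym : symmetric e.
Proof.
by move=> p q; rewrite /e (adj_sym p.1) (adj_sym p.2) (eq_sym p.1) (eq_sym p.2).
Qed.
Let e_irr : irreflexive e. Proof. by move=> p; rewrite /e !adj_irr !andbF. Qed.

Definition cart_prod : sgraph := SGraph e_sym e_irr.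
End CartesianProduct.

Section InducedSubgraph.
Variables (G : sgraph) (S : {set G}).
Let e : rel {x : G | x \in S} := fun x y => adj (val x) (val y).

Let e_sym : symmetric e. Proof. by move=> x y; apply: adj_sym. Qed.
Let e_irr : irreflexive e. Proof. by move=> x; apply: adj_irr. Qed.

Definition induced : sgraph := SGraph e_sym e_irr.
End InducedSubgraph.

Record ghom (G H : sgraph) := GHom {
  ghom_fun :> G -> H;
  ghom_adj : forall x y, adj x y -> adj (ghom_fun x) (ghom_fun y)
}.

Section Inclusion.
Variables (G : sgraph) (S T : {set G}) (sST : S \subset T).

Definition incl_fun (x : induced S) : induced T :=
  exist _ (val x) (subsetP sST _ (valP x)).

Lemma incl_adj x y : adj x y -> adj (incl_fun x) (incl_fun y).
Proof. by []. Qed.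

Definition incl : ghom (induced S) (induced T) := GHom incl_adj.
End Inclusion.

Section H0.
Variable G : sgraph.

(* Both orientations of each edge are generators of the 1-chains: since
   [x,y] and [y,x] have opposite boundaries, this does not change the image
   of the boundary map. *)
Definition dart : finType := {p : G * G | adj p.1 p.2}.

Definition chain0 : zmodType := {ffun G -> int}.
Definition chain1 : zmodType := {ffun dart -> int}.

Definition vchain (x : G) : chain0 := [ffun y => (x == y)%:R].

Definition boundary (c : chain1) : chain0 :=
  \sum_(p : dart) (vchain (val p).2 - vchain (val p).1) *~ c p.

Lemma boundary_is_zmod_morphism : zmod_morphism boundary.
Proof.
move=> c d; rewrite /boundary -sumrB; apply: eq_bigr => p _.
by rewrite !ffunE mulrzBr.
Qed.
HB.instance Definition _ :=
  GRing.isZmodMorphism.Build chain1 chain0 boundary boundary_is_zmod_morphism.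

Definition H0 : zmodType := coker boundary.

Definition H0_class (c : chain0) : H0 := \pi_(Quotient.quot (im boundary)) c.

Lemma H0_class_is_zmod_morphism : zmod_morphism H0_class.
Proof. by move=> c d; rewrite /H0_class raddfB. Qed.
HB.instance Definition _ :=
  GRing.isZmodMorphism.Build chain0 H0 H0_class H0_class_is_zmod_morphism.

Lemma H0_classP c d :
  reflect (exists b, c - d = boundary b) (H0_class c == H0_class d).
Proof. by rewrite -Quotient.idealrBE; apply: imP. Qed.

Definition H0_repr (h : H0) : chain0 := repr (h : Quotient.quot (im boundary)).

Lemma H0_reprK : cancel H0_repr H0_class.
Proof. by move=> h; apply: reprK. Qed.

End H0.

(* Keeps unification from unfolding the quotient; use [H0_class], [H0_classP]
   and [H0_reprK] instead. *)
Global Opaque H0.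

Section H0Map.
Variables (G H : sgraph) (f : ghom G H).

Definition chain0_map (c : chain0 G) : chain0 H := \sum_(x : G) vchain (f x) *~ c x.

Lemma chain0_map_is_zmod_morphism : zmod_morphism chain0_map.
Proof.
move=> c d; rewrite /chain0_map -sumrB; apply: eq_bigr => x _.
by rewrite !ffunE mulrzBr.
Qed.
HB.instance Definition _ := GRing.isZmodMorphism.Build
  (chain0 G) (chain0 H) chain0_map chain0_map_is_zmod_morphism.

Lemma chain0_map_vchain x : chain0_map (vchain x) = vchain (f x).
Proof.
rewrite /chain0_map (bigD1 x) //= big1 ?addr0 => [|y yx]; rewrite ffunE.
  by rewrite eqxx.
by rewrite eq_sym (negPf yx) mulr0z.
Qed.

Definition dart_map (p : dart G) : dart H :=
  exist (fun q : H * H => adj q.1 q.2)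
        (f (val p).1, f (val p).2) (ghom_adj f (valP p)).

Lemma chain0_map_boundary (c : chain1 G) :
  exists b, chain0_map (boundary c) = boundary b.
Proof.
suff: chain0_map (boundary c) \in im (@boundary H) by move/imP.
rewrite raddf_sum rpred_sum // => p _; rewrite raddfMz rpredMz //.
apply/imP; exists [ffun q => (q == dart_map p)%:R].
rewrite /= /boundary (bigD1 (dart_map p)) //= big1 => [|q /negPf qp]; last first.
  by rewrite ffunE qp mulr0z.
by rewrite ffunE eqxx addr0 raddfB /= !chain0_map_vchain.
Qed.

Definition H0_map (h : H0 G) : H0 H := H0_class (chain0_map (H0_repr h)).

Lemma H0_map_class c : H0_map (H0_class c) = H0_class (chain0_map c).
Proof.
apply/eqP/H0_classP; rewrite -raddfB.
have /H0_classP[b ->] : H0_class (H0_repr (H0_class c)) == H0_class c.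
  by rewrite H0_reprK.
exact: chain0_map_boundary.
Qed.

Lemma H0_map_is_zmod_morphism : zmod_morphism H0_map.
Proof.
move=> h k; rewrite -[h]H0_reprK -[k]H0_reprK -raddfB.
by rewrite !H0_map_class !raddfB.
Qed.
HB.instance Definition _ :=
  GRing.isZmodMorphism.Build (H0 G) (H0 H) H0_map H0_map_is_zmod_morphism.

End H0Map.

Lemma H0_map_comp (G H K : sgraph) (f : ghom G H) (g : ghom H K)
    (k : ghom G K) (h : H0 G) :
  (forall x, k x = g (f x)) -> H0_map g (H0_map f h) = H0_map k h.
Proof.
move=> kgf; rewrite -[h]H0_reprK !H0_map_class; congr H0_class.
rewrite [chain0_map f _]/chain0_map raddf_sum; apply: eq_bigr => x _.
by rewrite raddfMz /= chain0_map_vchain kgf.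
Qed.

Section BoldHomology.
Variables (G : sgraph) (le : rel G).

Definition subset_card (j : nat) : finType := {S : {set G} | #|S| == j}.

Definition cochain (j : nat) : zmodType :=
  dsum (fun S : subset_card j => H0 (induced (val S))).

Lemma remove_card j (T : subset_card j.+1) (v : {v : G | v \in val T}) :
  #|val T :\ val v| == j.
Proof. by have := valP T; rewrite /= (cardsD1 (val v)) (valP v) eqSS. Qed.

Definition remove j (T : subset_card j.+1) (v : {v : G | v \in val T}) :
  subset_card j := exist _ (val T :\ val v) (remove_card v).

Definition incl_remove j (T : subset_card j.+1) (v : {v : G | v \in val T}) :
  ghom (induced (val (remove v))) (induced (val T)) :=
  incl (subsetDl (val T) [set val v]).

Definition sign_exp (S : {set G}) (v : G) : nat :=
  #|[set w in S | (w != v) && le w v]|.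

(* The component at T collects the maps out of all S = T \ {v}, v \in T. *)
Definition differential j (x : cochain j) : cochain j.+1 :=
  dsum_of (fun T : subset_card j.+1 =>
    \sum_(v : {v : G | v \in val T})
      H0_map (incl_remove v) (x (remove v))
        *~ ((-1) ^+ sign_exp (val (remove v)) (val v))).

Lemma differential_is_zmod_morphism j : zmod_morphism (@differential j).
Proof.
move=> x y; apply/dsumP => T; rewrite dsumBE !dsum_ofE -sumrB.
by apply: eq_bigr => v _; rewrite dsumBE raddfB mulrzBl.
Qed.
HB.instance Definition _ j := GRing.isZmodMorphism.Build
  (cochain j) (cochain j.+1) (@differential j) (@differential_is_zmod_morphism j).

Lemma sign_exp_remove (S : {set G}) (v w : G) :
  v \in S -> sign_exp S w = (((v != w) && le v w) + sign_exp (S :\ v) w)%N.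
Proof.
move=> vS; rewrite /sign_exp (cardsD1 v) inE vS /=; congr (_ + _)%N.
by apply: eq_card => u; rewrite !inE -andbA.
Qed.

Lemma differential_differential j (x : cochain j) :
  total le -> transitive le -> antisymmetric le ->
  differential (differential x) = 0.
Proof.
move=> le_tot le_tr le_anti; apply/dsumP => U; rewrite dsum0E dsum_ofE.
pose k (A : {set G}) : H0 (induced (val U)) :=
  if insub A is Some B then
    if @idP (val (B : subset_card j) \subset val U) is ReflectT h
    then H0_map (incl h) (x B) else 0
  else 0.
have kE (B : subset_card j) (h : val B \subset val U) :
    k (val B) = H0_map (incl h) (x B).
  rewrite /k valK; destruct (@idP (val B \subset val U)) as [h'|nh]; last by case: nh.
  by rewrite (bool_irrelevance h' h).
pose n := sign_exp (val U).
have nE v : sign_exp (val U :\ v) v = n v.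
  rewrite /n /sign_exp; apply: eq_card => u; rewrite !inE.
  by case: (u == v); rewrite ?andbF.
pose F v w := k (val U :\ v :\ w) *~
  ((-1) ^+ (n v + sign_exp (val U :\ v :\ w) w)).
transitivity (\sum_(v in val U) \sum_(w in val U :\ v) F v w).
  rewrite [RHS]big_sub /=; apply: eq_bigr => v _.
  rewrite dsum_ofE [RHS]big_sub raddf_sum /= mulrz_suml.
  apply: eq_bigr => w _.
  rewrite /F (raddfMz (H0_map _)) -mulrzA -exprD [X in _ ^+ X]addnC.
  rewrite [sign_exp _ (val v)]nE.
  have h : val (@remove j (remove v) w) \subset val U.
    by apply: subset_trans (subsetDl _ _) (subsetDl _ _).
  have -> : k (val U :\ val v :\ val w) = H0_map (incl h) (x (@remove j (remove v) w)).
    exact: (kE (@remove j (remove v) w) h).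
  rewrite /= (@H0_map_comp _ _ _ _ _ (incl h)) //.
  by move=> z; apply: val_inj.
have FN v w : v \in val U -> w \in val U -> v != w -> le v w -> F w v = - F v w.
  move=> vU wU vw lvw; rewrite /F.
  have -> : val U :\ w :\ v = val U :\ v :\ w.
    by apply/setP => u; rewrite !inE andbCA.
  set A := val U :\ v :\ w.
  have wUv : w \in val U :\ v by rewrite !inE eq_sym vw.
  have vUw : v \in val U :\ w by rewrite !inE vw.
  have lwv : le w v = false.
    by apply/negP => lwv; move: vw; rewrite (le_anti v w) ?eqxx ?lvw.
  have nw : n w = (sign_exp A w).+1.
    rewrite /n (sign_exp_remove w vU) vw lvw add1n.
    by rewrite (sign_exp_remove w wUv) eqxx.
  have nv : n v = sign_exp A v.
    rewrite /n (sign_exp_remove v vU) eqxx /= add0n.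
    by rewrite (sign_exp_remove v wUv) lwv andbF.
  by rewrite nw nv addSn addnC exprS mulN1r mulrNz.
transitivity (\sum_(v in val U) \sum_(w in val U | (w != v) && le v w) F v w +
              \sum_(v in val U) \sum_(w in val U | (w != v) && le w v) F v w).
  rewrite -big_split; apply: eq_bigr => v vU /=.
  rewrite (bigID (le v)) /=; congr (_ + _); apply: eq_bigl => w; rewrite !inE.
    by rewrite andbAC andbC.
  have [->|wv] := eqVneq w v; first by rewrite /= andbF.
  rewrite /=; congr (_ && _); apply/idP/idP => [/negPf lvw|lwv].
    by have := le_tot v w; rewrite lvw.
  by apply/negP => lvw; move: wv; rewrite (le_anti v w) ?eqxx ?lvw.
apply/eqP; rewrite addr_eq0 -sumrN (exchange_big_dep (mem (val U))) /=.
  apply/eqP; apply: eq_bigr => v vU; rewrite -sumrN; apply: eq_big => [w|w].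
    by rewrite vU /= (eq_sym v w).
  by case/and4P=> wU _ vw lwv; rewrite (FN w v) 1?eq_sym ?opprK.
by move=> v w _ /andP[].
Qed.

Definition cocycle (j : nat) : zmodType := kernel (@differential j).

Definition coboundary (j : nat) : {pred cochain j} :=
  match j return {pred cochain j} with
  | 0 => pred1 0
  | i.+1 => im (@differential i)
  end.

Lemma coboundary_zmod_closed j : zmod_closed (@coboundary j).
Proof.
case: j => [|j]; last exact: im_zmod_closed.
by split=> [|x y]; rewrite !inE // => /eqP-> /eqP->; rewrite subrr.
Qed.
HB.instance Definition _ j :=
  GRing.isZmodClosed.Build (cochain j) (@coboundary j) (@coboundary_zmod_closed j).

(* Coboundaries are cocycles by [differential_differential] when [le] is a
   total order, so intersecting with the cocycles loses nothing. *)
Definition cocycle_coboundary (j : nat) : {pred cocycle j} :=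
  [pred z | val z \in @coboundary j].

Lemma cocycle_coboundary_zmod_closed j : zmod_closed (@cocycle_coboundary j).
Proof.
split=> [|x y]; rewrite !inE ?raddf0 ?rpred0 // => xB yB.
by rewrite raddfB rpredB.
Qed.
HB.instance Definition _ j := GRing.isZmodClosed.Build
  (cocycle j) (@cocycle_coboundary j) (@cocycle_coboundary_zmod_closed j).

Definition bold_homology (j : nat) : zmodType := Quotient.quot (@cocycle_coboundary j).

End BoldHomology.

(* Main.v *)
(** Every induced subgraph of the ladder becomes acyclic in positive degrees
    once its squares are filled in, so [S |-> H_0(G[S])] has the resolution
    [0 -> C_2(S) -> C_1(S) -> C_0(S) -> H_0(G[S]) -> 0] by the cellular chains on
    the squares, edges and vertices contained in [S].  Along the cube of all [S],
    each cell contributes a complex which is contracted by adding a vertex outside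
    the cell; such a vertex exists for every cell, squares included, exactly
    because there are at least three columns.  Hence the cube complexes of
    [C_0], [C_1] and [C_2] are acyclic, and so is that of [H_0]. *)
Require Import Defs.
From mathcomp Require Import all_boot all_algebra.
From mathcomp Require Import boolp zify ring.

Set Implicit Arguments.
Unset Strict Implicit.
Unset Printing Implicit Defensive.

Import GRing.Theory.
Local Open Scope ring_scope.

(** * The cube of vertex subsets with integer coefficients *)

Section CubeDifferential.
Variables (G : sgraph) (le : rel G).
Hypotheses (le_total : total le) (le_anti : antisymmetric le).
Implicit Types (S T : {set G}) (f g : {set G} -> int).

(** A single cell contributes one integer for each [S], zero when [S] misses part of the cell; all
    cardinalities of [S] are handled at once. *)
Definition cube_diff (f : {set G} -> int) (T : {set G}) : int :=
  \sum_(v in T) (-1) ^+ sign_exp le T v * f (T :\ v).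

Lemma eq_cube_diff f g : f =1 g -> cube_diff f =1 cube_diff g.
Proof. by move=> fg T; apply: eq_bigr => v _; rewrite fg. Qed.

Lemma cube_diffB f g T :
  cube_diff (fun S => f S - g S) T = cube_diff f T - cube_diff g T.
Proof. by rewrite -sumrB; apply: eq_bigr => v _; rewrite mulrBr. Qed.

Lemma cube_diff_support (P : pred {set G}) f T :
  (forall S T, S \subset T -> P S -> P T) ->
  (forall S, ~~ P S -> f S = 0) -> ~~ P T -> cube_diff f T = 0.
Proof.
move=> Pmono fP PT; apply: big1 => v _; rewrite fP ?mulr0 //.
by apply: contra PT; apply: Pmono; apply: subsetDl.
Qed.

(** Deleting [v] lowers the exponent at [w] by one exactly when [v] precedes [w]. Exactly one of [v]
    and [w] precedes the other, so exactly one of the two exponents drops. *)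
Lemma sign_swap (T : {set G}) v w : v \in T -> w \in T -> v != w ->
  (-1) ^+ sign_exp le T v * (-1) ^+ sign_exp le (T :\ v) w =
  - ((-1) ^+ sign_exp le T w * (-1) ^+ sign_exp le (T :\ w) v) :> int.
Proof.
move=> vT wT vw.
rewrite (sign_exp_remove le w vT) (sign_exp_remove le v wT) vw eq_sym vw /= !exprD.
have : le v w (+) le w v.
  have := le_total v w; have := @le_anti v w.
  case: (le v w); case: (le w v) => //= e _.
  by rewrite e ?eqxx in vw.
by case: (le v w); case: (le w v) => //= _; rewrite ?expr0 ?expr1; ring.
Qed.

Lemma cube_diff_diff f T : cube_diff (cube_diff f) T = 0.
Proof.
pose F v w := (-1) ^+ sign_exp le T v * (-1) ^+ sign_exp le (T :\ v) w
              * f (T :\ v :\ w) : int.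
have -> : cube_diff (cube_diff f) T =
    \sum_(v in T) \sum_(w in T | v != w) F v w.
  apply: eq_bigr => v _; rewrite mulr_sumr; apply: eq_big => [w|w _].
    by rewrite !inE andbC eq_sym.
  by rewrite mulrA.
(* Exchanging the two deleted vertices negates the double sum. *)
set s := (X in X = 0); suff : s = - s by lia.
rewrite {1}/s (exchange_big_dep (mem T)) /=; last by move=> v w _ /andP[].
rewrite -sumrN; apply: eq_bigr => w wT; rewrite -sumrN.
apply: eq_big => [v|v /and3P[vT _ vw]]; first by rewrite wT eq_sym.
rewrite /F sign_swap // mulNr; congr (- (_ * f _)).
by apply/setP => u; rewrite !inE andbCA.
Qed.

(* The contracting homotopy inserts the vertex [v], with the matching sign. *)
Lemma cube_diff_exact (v : G) (P : pred {set G}) f :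
  (forall S, P (v |: S) = P S) -> (forall S, ~~ P S -> f S = 0) ->
  (forall T, cube_diff f T = 0) ->
  exists g, (forall S, ~~ P S -> g S = 0) /\ (forall T, cube_diff g T = f T).
Proof.
move=> Pv fP df0.
pose g S : int := if v \in S then 0 else (-1) ^+ sign_exp le (v |: S) v * f (v |: S).
exists g; split=> [S nPS|T]; first by rewrite /g fP ?mulr0 ?if_same ?Pv.
(* For [v] in [T] only the term deleting [v] survives, since [g] is zero on sets that contain
   [v]. *)
have [vT|vT] := boolP (v \in T).
  rewrite /cube_diff (bigD1 v) //= big1 ?addr0 => [|w /andP[wT wv]].
    by rewrite /g setD11 setD1K // mulrA -expr2 sqrr_sign mul1r.
  by rewrite /g !inE eq_sym wv vT /= mulr0.
(* For [v] outside [T], the cocycle condition at [v |: T] expresses [f T] through sets that still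
   contain [v], which are the ones [g] reads. *)
have := df0 (v |: T); rewrite /cube_diff (bigD1 v) ?setU11 //= setU1K // => dfvT.
have {dfvT} fT : f T = - ((-1) ^+ sign_exp le (v |: T) v *
    \sum_(w in v |: T | w != v) (-1) ^+ sign_exp le (v |: T) w * f ((v |: T) :\ w)).
  move/eqP: dfvT; rewrite addrC addr_eq0 => /eqP->.
  by rewrite mulrN opprK mulrA -expr2 sqrr_sign mul1r.
rewrite fT mulr_sumr -sumrN; apply: eq_big => [w|w wT].
  by rewrite !inE; case: eqVneq => [->|] //=; rewrite ?andbT // (negPf vT).
have vw : v != w by apply: contraNneq vT => ->.
have wvT : w \in v |: T by rewrite setU1r.
have eT : (v |: T) :\ w = v |: (T :\ w).
  by apply/setP => u; rewrite !inE; case: eqVneq => [->|]; rewrite ?andbT // eq_sym (negPf vw).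
rewrite eT /g !inE (negPf vT) andbF.
have := sign_swap (setU11 v T) wvT vw; rewrite setU1K // eT => sw.
rewrite !mulrA -mulNr; congr (_ * _).
have sq n : (-1) ^+ n * (-1) ^+ n = 1 :> int by rewrite -expr2 sqrr_sign.
move: (sq (sign_exp le (v |: T) v)) (sq (sign_exp le (v |: T :\ w) v)) sw.
(* In these signs the swap relation is [a b = - c d]; multiplying by [a d] gives [b d = - a c]. *)
set a := (-1) ^+ sign_exp le (v |: T) v; set b := (-1) ^+ sign_exp le T w.
set c := (-1) ^+ sign_exp le (v |: T) w; set d := (-1) ^+ sign_exp le _ v.
move=> aa dd sw.
transitivity (a * (a * b) * d); first by rewrite mulrA aa mul1r.
transitivity (- (a * c) * (d * d)); first by rewrite sw; ring.
by rewrite dd mulr1.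
Qed.
End CubeDifferential.

(** * Vertex chains on induced subgraphs and their classes in [H0] *)

Section VertexCochains.
Variable G : sgraph.
Implicit Types (S T : {set G}) (f g : G -> int).

Definition restrict (S : {set G}) (f : G -> int) : chain0 (induced S) :=
  [ffun u => f (val u)].

Definition extend (S : {set G}) (c : chain0 (induced S)) (x : G) : int :=
  if insub x is Some u then c u else 0.

Lemma extendK S : cancel (@extend S) (@restrict S).
Proof. by move=> c; apply/ffunP => u; rewrite ffunE /extend valK. Qed.

Lemma extend_out S (c : chain0 (induced S)) x : x \notin S -> extend c x = 0.
Proof. by move=> xS; rewrite /extend insubN. Qed.

Lemma restrictB S f g : restrict S (fun x => f x - g x) = restrict S f - restrict S g.
Proof. by apply/ffunP => u; rewrite !ffunE. Qed.

(** Functions on all of [G] let chains on different induced subgraphs share one type. *)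
Definition cls (S : {set G}) (f : G -> int) : H0 (induced S) :=
  H0_class (restrict S f).

Lemma cls_eq S f g : {in S, f =1 g} -> cls S f = cls S g.
Proof.
by move=> fg; congr H0_class; apply/ffunP => u; rewrite !ffunE fg // (valP u).
Qed.

Lemma clsB S f g : cls S (fun x => f x - g x) = cls S f - cls S g.
Proof. by rewrite /cls restrictB raddfB. Qed.

Lemma cls_sum S (I : finType) (P : pred I) (F : I -> G -> int) (a : I -> int) :
  cls S (fun x => \sum_(i | P i) a i * F i x) = \sum_(i | P i) cls S (F i) *~ a i.
Proof.
rewrite /cls; have -> : restrict S (fun x => \sum_(i | P i) a i * F i x) =
    \sum_(i | P i) restrict S (F i) *~ a i.
  apply/ffunP => u; rewrite ffunE sum_ffunE; apply: eq_bigr => i _.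
  by rewrite ffunMzE ffunE mulrzz mulrC.
by rewrite raddf_sum; apply: eq_bigr => i _; rewrite raddfMz.
Qed.

(** Pushing forward along an inclusion is extension by zero, which leaves such an [f] unchanged. *)
Lemma H0_map_incl_cls (S T : {set G}) (sST : S \subset T) f :
  (forall x, x \notin S -> f x = 0) -> H0_map (incl sST) (cls S f) = cls T f.
Proof.
move=> fS; rewrite /cls H0_map_class; congr H0_class; apply/ffunP => u.
rewrite sum_ffunE ffunE.
have [uS|uS] := boolP (val u \in S).
  rewrite (bigD1 (exist _ (val u) uS : induced S)) //= big1 ?addr0 => [|x xu].
    rewrite ffunMzE !ffunE (_ : incl_fun _ _ == u) ?mulrzz ?mul1r //.
    by apply/eqP/val_inj.
  rewrite ffunMzE ffunE (_ : incl_fun _ _ == u = false) ?mul0rz //.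
  by apply: contraNF xu => /eqP/(congr1 val) e; apply/eqP/val_inj.
rewrite fS // big1 // => x _; rewrite ffunMzE ffunE.
rewrite (_ : incl sST x == u = false) ?mul0rz //.
by apply: contraNF uS => /eqP <-; apply: (valP x).
Qed.

(** This moves the bold differential to representatives, where it acts at each vertex separately. *)
Lemma differential_cls (le : rel G) j (x : cochain G j)
    (a : {set G} -> G -> int) (T : subset_card G j.+1) :
  (forall S y, y \notin S -> a S y = 0) ->
  (forall B, x B = cls (val B) (a (val B))) ->
  differential le x T =
    cls (val T) (fun y => cube_diff le (fun S => a S y) (val T)).
Proof.
move=> aS xa; rewrite dsum_ofE cls_sum [RHS]big_sub; apply: eq_bigr => v _.
rewrite xa H0_map_incl_cls; last exact: aS.
(* [sign_exp] skips [v] itself, so deleting [v] first does not change the exponent. *)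
congr (_ *~ (_ ^+ _)); apply: eq_card => u; rewrite !inE.
by case: (u == val v); rewrite ?andbF.
Qed.
End VertexCochains.

(** * Vertices, edges and squares of the ladder *)

Section Ladder.
Variable m : nat.
Local Notation ladder := (cart_prod (path_graph m) (path_graph 2)).
Implicit Types (S T : {set ladder}) (x y z : ladder).

Definition col x : nat := (x.1 : 'I_m).
Definition row x : 'I_2 := x.2.

Lemma ladder_eqE x y : (x == y) = (col x == col y) && (row x == row y).
Proof. by []. Qed.

Lemma ladder_eq x y : col x = col y -> row x = row y -> x = y.
Proof. by move=> cxy rxy; apply/eqP; rewrite ladder_eqE cxy rxy !eqxx. Qed.

(* [(i, Some r)] is the edge from column [i] to column [i + 1] in row [r], and
   [(i, None)] the rung in column [i]; columns are unbounded, and the cells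
   outside the ladder never carry a nonzero coefficient. *)
Definition cell := (nat * option 'I_2)%type.

Definition prev (f : nat -> int) (i : nat) : int := if i is i'.+1 then f i' else 0.

(** The cellular boundary of an edge chain, read at [x]: row edges point to the next column, rungs
    from row [ord0] to row [ord_max]. *)
Definition edge_bd (c : cell -> int) x : int :=
  prev (fun i => c (i, Some (row x))) (col x) - c (col x, Some (row x)) +
  (if row x == ord0 then - c (col x, None) else c (col x, None)).

(** Square [i] lies between columns [i] and [i + 1]; its boundary runs forward along row [ord0],
    along rung [i + 1], back along row [ord_max] and back along rung [i]. *)
Definition square_bd (s : nat -> int) (k : cell) : int :=
  match k.2 with
  | Some r => if r == ord0 then s k.1 else - s k.1
  | None => prev s k.1 - s k.1
  end.

Definition is_edge (k : cell) x y : bool :=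
  match k.2 with
  | Some r => [&& col x == k.1, col y == k.1.+1, row x == r & row y == r]
  | None => [&& col x == k.1, col y == k.1, row x == ord0 & row y == ord_max]
  end.

Definition spans (k : cell) S : bool :=
  [exists x in S, exists y in S, is_edge k x y].

(** The two row edges contain all four corners of the square. *)
Definition spans_square (i : nat) S : bool :=
  spans (i, Some ord0) S && spans (i, Some ord_max) S.

Lemma spansP k S :
  reflect (exists x y, [/\ x \in S, y \in S & is_edge k x y]) (spans k S).
Proof.
apply: (iffP exists_inP) => [[x xS /exists_inP[y yS e]]|[x [y [xS yS e]]]].
  by exists x, y.
by exists x => //; apply/exists_inP; exists y.
Qed.

Lemma ord2P (r : 'I_2) : r = ord0 \/ r = ord_max.
Proof. by case: r => [[|[|//]] ?]; [left | right]; apply: val_inj. Qed.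

Lemma spans_mono k S T : S \subset T -> spans k S -> spans k T.
Proof.
move/subsetP => sST /spansP[x [y [xS yS e]]]; apply/spansP.
by exists x, y; split; rewrite ?sST.
Qed.

Lemma is_edge_col k x y : is_edge k x y ->
  col x = k.1 /\ (col y = k.1 \/ col y = k.1.+1).
Proof.
case: k => i [r|] /and4P[/eqP-> /eqP-> _ _]; split=> //; first by right.
by left.
Qed.

Lemma is_edge_adj k x y : is_edge k x y -> adj x y.
Proof.
case: k => i [r|] /and4P[/eqP cx /eqP cy /eqP rx /eqP ry]; apply/orP.
  right; apply/andP; split; first by apply/eqP; rewrite -[LHS]/(row x) rx -ry.
  by apply/orP; left; rewrite -[X in X.+1]/(col x) cx; apply/eqP.
left; apply/andP; split.
  by apply/eqP/val_inj; rewrite /= -[LHS]/(col x) cx -cy.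
by apply/orP; left; rewrite -[X in nat_of_ord X]/(row x) rx -[X in _ == nat_of_ord X]/(row y) ry.
Qed.

Lemma adj_is_edge x y : adj x y -> exists k, is_edge k x y \/ is_edge k y x.
Proof.
move=> /orP[/andP[/eqP cxy /orP rxy]|/andP[/eqP rxy /orP cxy]].
  have {}cxy : col x = col y by rewrite /col cxy.
  exists (col x, None); rewrite /is_edge /= -cxy !eqxx /=.
  have [r0 r1] := (ord2P (row x), ord2P (row y)).
  case: rxy => /eqP; rewrite -/(row x) -/(row y);
    case: r0 => ->; case: r1 => -> //= _; by [left | right].
have {}rxy : row x = row y by [].
case: cxy => /eqP cxy; [exists (col x, Some (row x)) | exists (col y, Some (row x))].
  by left; rewrite /is_edge /= -rxy !eqxx /= andbT; apply/eqP.
by right; rewrite /is_edge /= -rxy !eqxx /= andbT; apply/eqP.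
Qed.

Lemma edge_bd_delta k x y z : is_edge k x y ->
  edge_bd (fun l => (k == l)%:R) z = (y == z)%:R - (x == z)%:R.
Proof.
rewrite !ladder_eqE /edge_bd.
have rz := ord2P (row z).
case: k => i [r|] /and4P[/eqP-> /eqP-> /eqP-> /eqP->].
  rewrite !xpair_eqE !andbF /= oppr0 if_same addr0.
  by case: (col z) => [|j] /=; rewrite ?xpair_eqE ?eqSS.
rewrite /= !xpair_eqE !andbF !andbT subr0.
have -> : prev (fun i0 => ((i, None) == (i0, Some (row z)))%:R) (col z) = 0.
  by case: (col z) => //= j; rewrite xpair_eqE andbF.
by case: rz => ->; rewrite /= ?andbT ?andbF ?add0r ?subr0 ?sub0r.
Qed.

Lemma edge_bd_sum (I : finType) (P : pred I) (F : I -> cell -> int) (a : I -> int) x :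
  edge_bd (fun k => \sum_(i | P i) a i * F i k) x =
  \sum_(i | P i) a i * edge_bd (F i) x.
Proof.
have prev_sum r j : prev (fun i => \sum_(l | P l) a l * F l (i, Some r)) j =
    \sum_(l | P l) a l * prev (fun i => F l (i, Some r)) j.
  by case: j => //=; rewrite big1 // => l _; rewrite mulr0.
rewrite /edge_bd prev_sum -sumrB.
case: ifP => _; rewrite -?sumrN -big_split; apply: eq_bigr => l _ /=; ring.
Qed.

Lemma edge_bdB c d x :
  edge_bd (fun k => c k - d k) x = edge_bd c x - edge_bd d x.
Proof. by rewrite /edge_bd; case: ifP; case: (col x) => *; rewrite /=; ring. Qed.

(** * The cellular chain complex of an induced subgraph *)

Lemma edge_square_bd s x : edge_bd (square_bd s) x = 0.
Proof.
rewrite /edge_bd /square_bd /=; case: (ord2P (row x)) => ->; rewrite /=;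
  by case: (col x) => * /=; ring.
Qed.

(** Sweeping from left to right, the cycle condition in row [ord0] of a column fixes its rung, and
    the one in row [ord_max] then fixes the next edge of that row. *)
Lemma square_bd_eqP S c :
  (forall k, ~~ spans k S -> c k = 0) -> (forall x, edge_bd c x = 0) ->
  c =1 square_bd (fun i => c (i, Some ord0)).
Proof.
move=> cS c0.
have vertex i r : (i < m)%N -> exists x, col x = i /\ row x = r.
  by move=> im; exists (Ordinal im, r).
have out i o : (m <= i)%N -> c (i, o) = 0.
  move=> mi; apply: cS; apply/negP => /spansP[x [y [_ _ /is_edge_col[/= cx _]]]].
  by have := ltn_ord (x.1 : 'I_m); rewrite -[nat_of_ord _]/(col x) cx ltnNge mi.
(* A row edge starting in the last column would end in column [m]. Its vanishing settles the claim
   at column [m], where [prev] still reads column [m - 1]. *)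
have out_last i r : (m <= i.+1)%N -> c (i, Some r) = 0.
  move=> mi; apply: cS; apply/negP => /spansP[x [y [_ _ /and4P[_ /eqP/= cy _ _]]]].
  by have := ltn_ord (y.1 : 'I_m); rewrite -[nat_of_ord _]/(col y) cy ltnNge mi.
have rows i : c (i, None) = prev (fun i => c (i, Some ord0)) i - c (i, Some ord0)
    /\ c (i, Some ord_max) = - c (i, Some ord0).
  elim: i => [|i [_ IH]].
    have [m0|m_gt0] := leqP m 0; first by rewrite !out //=.
    have [x [cx rx]] := vertex 0%N ord0 m_gt0; have := c0 x.
    have [y [cy ry]] := vertex 0%N ord_max m_gt0; have := c0 y.
    rewrite /edge_bd cx rx cy ry /=; lia.
  have [mi|im] := leqP m i.+1; first by rewrite !out //= out_last //.
  have [x [cx rx]] := vertex i.+1%N ord0 im; have := c0 x.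
  have [y [cy ry]] := vertex i.+1%N ord_max im; have := c0 y.
  rewrite /edge_bd cx rx cy ry /= IH; lia.
move=> [i [r|]]; rewrite /square_bd /=; last by have [] := rows i.
by case: (ord2P r) => -> //=; have [] := rows i.
Qed.

Lemma edge_bd_out S c x :
  (forall k, ~~ spans k S -> c k = 0) -> x \notin S -> edge_bd c x = 0.
Proof.
move=> cS xS; rewrite /edge_bd.
have -> : prev (fun i => c (i, Some (row x))) (col x) = 0.
  case cx: (col x) => [|i] //=; apply: cS.
  apply: contra xS => /spansP[y [z [_ zS /and4P[_ /eqP cz _ /eqP rz]]]].
  by rewrite (@ladder_eq x z) ?cz.
have -> : c (col x, Some (row x)) = 0.
  apply: cS; apply: contra xS => /spansP[y [z [yS _ /and4P[/eqP cy _ /eqP ry _]]]].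
  by rewrite (@ladder_eq x y) ?cy.
have -> : c (col x, None) = 0; last by rewrite oppr0 if_same subr0 addr0.
apply: cS; apply: contra xS.
move=> /spansP[y [z [yS zS /and4P[/eqP cy /eqP cz /eqP ry /eqP rz]]]].
by have [rx|rx] := ord2P (row x);
  [rewrite (@ladder_eq x y) ?cy ?rx | rewrite (@ladder_eq x z) ?cz ?rx].
Qed.

Lemma spans_rung i S :
  spans_square i S || (if i is i'.+1 then spans_square i' S else false) ->
  spans (i, None) S.
Proof.
move=> sq; suff [x [y [xS yS [cx cy rx ry]]]] : exists x y,
    [/\ x \in S, y \in S & [/\ col x = i, col y = i, row x = ord0 & row y = ord_max]].
  by apply/spansP; exists x, y; rewrite /is_edge /= cx cy rx ry !eqxx.
case/orP: sq => [|].
  case/andP=> /spansP[x [_ [xS _ /and4P[/eqP cx _ /eqP rx _]]]].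
  by case/spansP=> y [_ [yS _ /and4P[/eqP cy _ /eqP ry _]]]; exists x, y.
case: i => // i /andP[/spansP[_ [x [_ xS /and4P[_ /eqP cx _ /eqP rx]]]]].
by case/spansP=> _ [y [_ yS /and4P[_ /eqP cy _ /eqP ry]]]; exists x, y.
Qed.

(** Every side of a spanned square is spanned, so the squares next to an unspanned edge carry
    coefficient 0. *)
Lemma square_bd_out S s k :
  (forall i, ~~ spans_square i S -> s i = 0) -> ~~ spans k S ->
  square_bd s k = 0.
Proof.
move=> sS; case: k => i [r|] kS; rewrite /square_bd /=.
  rewrite sS ?oppr0 ?if_same //; apply: contra kS => /andP[].
  by have [->|->] := ord2P r.
have := contra (@spans_rung i S) kS; rewrite negb_or => /andP[iS].
by rewrite (sS _ iS) subr0; case: i {kS iS} => //= i; apply: sS.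
Qed.

Lemma vchain_diff S x y (xS : x \in S) (yS : y \in S) :
  restrict S (fun z => (y == z)%:R - (x == z)%:R) =
  vchain (exist _ y yS : induced S) - vchain (exist _ x xS : induced S).
Proof. by apply/ffunP => u; rewrite !ffunE. Qed.

(** By linearity it suffices to treat one spanned edge, which is a dart of the induced subgraph. *)
Lemma cls_edge_bd S c :
  (forall k, ~~ spans k S -> c k = 0) -> cls S (edge_bd c) = 0.
Proof.
move=> cS.
(* The columns below [m] suffice, since no cell beyond them is spanned. *)
have cE : c =1 fun k => \sum_(l : 'I_m * option 'I_2)
    c (l.1 : nat, l.2) * ((l.1 : nat, l.2) == k)%:R.
  move=> [i o]; have [mi|im] := leqP m i.
    rewrite cS; last first.
      apply/negP => /spansP[x [y [_ _ /is_edge_col[/= cx _]]]].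
      by have := ltn_ord (x.1 : 'I_m); rewrite -[nat_of_ord _]/(col x) cx ltnNge mi.
    rewrite big1 // => -[j o'] _; rewrite xpair_eqE /=.
    by rewrite ltn_eqF ?mulr0 // (leq_trans (ltn_ord j)).
  rewrite (bigD1 (Ordinal im, o)) //= eqxx mulr1 big1 ?addr0 // => -[j o'].
  by rewrite !xpair_eqE -val_eqE /= => /negPf->; rewrite mulr0.
have -> : edge_bd c = fun x => \sum_(l : 'I_m * option 'I_2)
    c (l.1 : nat, l.2) * edge_bd (fun k => ((l.1 : nat, l.2) == k)%:R) x.
  by apply/funext => x; rewrite -edge_bd_sum; congr edge_bd; apply/funext.
rewrite cls_sum big1 // => -[i o] _ /=.
have [/spansP[x [y [xS yS e]]]|/cS->] := boolP (spans (i : nat, o) S); last by rewrite mulr0z.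
rewrite (_ : cls _ _ = 0) ?mul0rz //.
rewrite /cls (_ : restrict _ _ = vchain (exist _ y yS : induced S) -
    vchain (exist _ x xS : induced S)); last first.
  by rewrite -vchain_diff; congr restrict; apply/funext => z; apply: edge_bd_delta.
have xy : adj (exist _ x xS : induced S) (exist _ y yS : induced S).
  exact: (is_edge_adj e).
rewrite raddfB /=; apply/eqP; rewrite subr_eq0; apply/H0_classP.
pose p : dart (induced S) := exist _ (_, _) xy.
exists [ffun q => (p == q)%:R]; rewrite /boundary (bigD1 p) //= big1 => [|q qp].
  by rewrite ffunE eqxx addr0.
by rewrite ffunE eq_sym (negPf qp) mulr0z.
Qed.

(** Each dart of the induced subgraph is a spanned edge up to orientation, so simplicial boundaries
    are cellular ones. *)
Lemma cls_eq0 S f : cls S f = 0 ->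
  exists c, (forall k, ~~ spans k S -> c k = 0) /\ {in S, f =1 edge_bd c}.
Proof.
move=> f0; have /H0_classP[b] : cls S f == H0_class 0 by rewrite f0 raddf0.
rewrite subr0 => fb.
have dart_chain (p : dart (induced S)) : exists c : cell -> int,
    (forall k, ~~ spans k S -> c k = 0) /\
    restrict S (edge_bd c) = vchain (val p).2 - vchain (val p).1.
  case: p => -[[x xS] [y yS]] /= e.
  rewrite -vchain_diff; have [k [ek|ek]] := @adj_is_edge x y e.
    exists (fun l => (k == l)%:R); split=> [l lS|].
      rewrite (_ : k == l = false) //; apply: contraNF lS => /eqP <-.
      by apply/spansP; exists x, y.
    by apply/ffunP => u; rewrite !ffunE (edge_bd_delta _ ek).
  exists (fun l => 0 - (k == l)%:R); split=> [l lS|].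
    rewrite (_ : k == l = false) ?subr0 //; apply: contraNF lS => /eqP <-.
    by apply/spansP; exists y, x.
  apply/ffunP => u; rewrite !ffunE edge_bdB (edge_bd_delta _ ek).
  by rewrite (_ : edge_bd _ _ = 0) ?sub0r ?opprB // /edge_bd; case: ifP; case: (col _).
have {dart_chain} [F /all_and2[FS Fbd]] := boolp.choice dart_chain.
exists (fun k => \sum_p b p * F p k); split=> [k kS|x xS].
  by rewrite big1 // => p _; rewrite FS ?mulr0.
rewrite edge_bd_sum; have /ffunP/(_ (exist _ x xS)) := fb.
rewrite ffunE => /= ->; rewrite sum_ffunE; apply: eq_bigr => p _.
by rewrite ffunMzE -Fbd ffunE mulrzz mulrC.
Qed.

(** * Contracting the cubes of the cells *)

Hypothesis m_ge3 : (3 <= m)%N.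

(** Column 2 is free when [i = 0], and column 0 otherwise; the bound on [m] supplies column 2. *)
Lemma far_vertex i : exists v : ladder, col v != i /\ col v != i.+1.
Proof.
have m_gt0 : (0 < m)%N by apply: leq_trans m_ge3.
by case: i => [|i]; [exists (Ordinal m_ge3, ord0) | exists (Ordinal m_gt0, ord0)].
Qed.

Lemma spans_setU1 k v S : col v != k.1 -> col v != k.1.+1 ->
  spans k (v |: S) = spans k S.
Proof.
move=> v0 v1; apply/idP/idP; last exact/spans_mono/subsetUr.
case/spansP=> x [y [xS yS e]]; apply/spansP; exists x, y.
have [cx cy] := is_edge_col e.
have inS z : z \in v |: S -> col z = k.1 \/ col z = k.1.+1 -> z \in S.
  move=> /setU1P[->|//] [zE|zE]; first by rewrite zE eqxx in v0.
  by rewrite zE eqxx in v1.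
by split; rewrite ?inS //; left.
Qed.

Section Exactness.
Variable le : rel ladder.
Hypotheses (le_total : total le) (le_anti : antisymmetric le).
Local Notation d := (cube_diff le).

(** The cube splits over the vertices [x]; each piece is contracted by a vertex in another column,
    and choice collects the primitives. *)
Lemma vertex_cochain_exact (a : {set ladder} -> ladder -> int) :
  (forall S x, x \notin S -> a S x = 0) ->
  (forall T x, d (a^~ x) T = 0) ->
  exists b, (forall S x, x \notin S -> b S x = 0) /\
            (forall T x, d (b^~ x) T = a T x).
Proof.
move=> aS da0.
have H x : exists g : {set ladder} -> int,
    (forall S, x \notin S -> g S = 0) /\ (forall T, d g T = a T x).
  have [v [v0 _]] := far_vertex (col x).
  apply: (cube_diff_exact le_total le_anti (v := v) (P := fun S => x \in S)) => // S.
    by rewrite !inE; case: eqVneq => // e; rewrite e eqxx in v0.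
  exact: aS.
have {H} [g /all_and2[gS dg]] := boolp.choice H.
by exists (fun S x => g x S); split=> [S x|T x]; [apply: gS | apply: dg].
Qed.

Lemma edge_cochain_exact (c : {set ladder} -> cell -> int) :
  (forall S k, ~~ spans k S -> c S k = 0) ->
  (forall T k, d (c^~ k) T = 0) ->
  exists b, (forall S k, ~~ spans k S -> b S k = 0) /\
            (forall T k, d (b^~ k) T = c T k).
Proof.
move=> cS dc0.
have H k : exists g : {set ladder} -> int,
    (forall S, ~~ spans k S -> g S = 0) /\ (forall T, d g T = c T k).
  have [v [v0 v1]] := far_vertex k.1.
  apply: (cube_diff_exact le_total le_anti (v := v) (P := spans k)) => // S.
    exact: spans_setU1.
  exact: cS.
have {H} [g /all_and2[gS dg]] := boolp.choice H.
by exists (fun S k => g k S); split=> [S k|T k]; [apply: gS | apply: dg].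
Qed.

Lemma square_cochain_exact (s : {set ladder} -> nat -> int) :
  (forall S i, ~~ spans_square i S -> s S i = 0) ->
  (forall T i, d (s^~ i) T = 0) ->
  exists b, (forall S i, ~~ spans_square i S -> b S i = 0) /\
            (forall T i, d (b^~ i) T = s T i).
Proof.
move=> sS ds0.
have H i : exists g : {set ladder} -> int,
    (forall S, ~~ spans_square i S -> g S = 0) /\ (forall T, d g T = s T i).
  have [v [v0 v1]] := far_vertex i.
  apply: (cube_diff_exact le_total le_anti (v := v) (P := spans_square i)) => // S.
    by rewrite /spans_square !spans_setU1.
  exact: sS.
have {H} [g /all_and2[gS dg]] := boolp.choice H.
by exists (fun S i => g i S); split=> [S i|T i]; [apply: gS | apply: dg].
Qed.

(** * Descent from the cells to [H0] *)

Lemma cube_diff_edge_bd (c : {set ladder} -> cell -> int) T x :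
  d (fun S => edge_bd (c S) x) T = edge_bd (fun k => d (c^~ k) T) x.
Proof. by rewrite [RHS]edge_bd_sum. Qed.

Lemma cube_diff_square_bd (s : {set ladder} -> nat -> int) T k :
  d (fun S => square_bd (s S) k) T = square_bd (fun i => d (s^~ i) T) k.
Proof.
have dN f : d (fun S => - f S) T = - d f T.
  by rewrite -sumrN; apply: eq_bigr => v _; rewrite mulrN.
case: k => i [r|]; rewrite /square_bd /=; first by case: ifP.
case: i => [|i] /=; last exact: cube_diffB.
by rewrite sub0r -dN; apply: eq_cube_diff => S; rewrite sub0r.
Qed.

(* [d c] is a cochain of edge cycles, that is, the boundary of a cochain [s] of
   squares; as [d s = 0], [s] is some [d b2], and [c - square_bd b2] is [d b]. *)
Lemma edge_cochain_adjust (c : {set ladder} -> cell -> int) :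
  (forall S k, ~~ spans k S -> c S k = 0) ->
  (forall T x, edge_bd (fun k => d (c^~ k) T) x = 0) ->
  exists b, (forall S k, ~~ spans k S -> b S k = 0) /\
            (forall T x, edge_bd (fun k => d (b^~ k) T) x = edge_bd (c T) x).
Proof.
move=> cS dc0.
have dcS T k : ~~ spans k T -> d (c^~ k) T = 0.
  apply: (@cube_diff_support _ _ (spans k)) => [S U|S]; first exact: spans_mono.
  exact: cS.
pose s T i := d (c^~ (i, Some ord0)) T.
have dcE T : (fun k => d (c^~ k) T) =1 square_bd (s T).
  by apply: (@square_bd_eqP T) => [k|x]; [apply: dcS | apply: dc0].
have sS T i : ~~ spans_square i T -> s T i = 0.
  (* If the edge in row [ord0] is missing, [s] vanishes by support; if the one in row [ord_max] is
     missing, its zero coefficient equals [- s]. *)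
  rewrite negb_and => /orP[|/dcS/eqP]; first exact: dcS.
  by rewrite dcE /square_bd /= oppr_eq0 => /eqP.
have ds0 T i : d (s^~ i) T = 0 by apply: cube_diff_diff.
have [b2 [b2S db2]] := square_cochain_exact sS ds0.
have [||b1 [b1S db1]] := @edge_cochain_exact (fun S k => c S k - square_bd (b2 S) k).
- by move=> S k kS; rewrite cS ?(@square_bd_out S) ?subrr // => i; apply: b2S.
- move=> T k; rewrite cube_diffB cube_diff_square_bd dcE.
  by rewrite (_ : (fun i => _) = s T) ?subrr //; apply/funext => i; apply: db2.
exists b1; split=> // T x.
rewrite (_ : (fun k => _) = fun k => c T k - square_bd (b2 T) k); last first.
  by apply/funext => k; apply: db1.
by rewrite edge_bdB edge_square_bd subr0.
Qed.

(** A chase through the resolution: lift the cocycle to vertex chains [a], correct [a] by an edge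
    boundary until it is a cocycle, and project a primitive back to [H0]. *)
Lemma cocycle_is_coboundary j (x : cochain ladder j) :
  differential le x = 0 -> x \in @coboundary ladder le j.
Proof.
move=> dx0.
(* Representatives of [x], extended by zero off [S] and set to zero when [S] does not have [j]
   elements. *)
pose a (S : {set ladder}) y : int :=
  if insub S is Some B then extend (H0_repr (x (B : subset_card ladder j))) y else 0.
have aS S y : y \notin S -> a S y = 0.
  move=> yS; rewrite /a; case: insubP => // B _ BS.
  by apply: extend_out; rewrite BS.
have xa B : x B = cls (val B) (a (val B)).
  by rewrite /a valK /cls extendK H0_reprK.
have daS T y : y \notin T -> d (a^~ y) T = 0.
  apply: (@cube_diff_support _ _ (fun S => y \in S)) => [S U /subsetP|S]; first exact.
  exact: aS.
(* For [T] of size [j + 1] the class of [d a] is the value of [differential le x], which is zero;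
   for other sizes [d a] itself is zero. *)
have lift T : exists c : cell -> int, (forall k, ~~ spans k T -> c k = 0) /\
    forall y, d (a^~ y) T = edge_bd c y.
  have [Tj|Tj] := eqVneq #|T| j.+1; last first.
    exists (fun _ => 0); split=> // y; rewrite /cube_diff big1 => [|v vT].
      by rewrite /edge_bd; case: ifP; case: (col y) => //=.
    rewrite /a insubN ?mulr0 //=; apply: contra Tj => /eqP <-.
    by rewrite (cardsD1 v) vT.
  pose B : subset_card ladder j.+1 := exist _ T (introT eqP Tj).
  have := differential_cls le B aS xa; rewrite dx0 dsum0E => /esym/cls_eq0[c [cT ac]].
  exists c; split=> // y; have [yT|yT] := boolP (y \in T); first exact: ac.
  by rewrite daS // (edge_bd_out cT).
have {lift} [c /all_and2[cS dac]] := boolp.choice lift.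
have [||b1 [b1S b1E]] := @edge_cochain_adjust c; first exact: cS.
  (* The boundary of [d c] is [d] of the boundary of [c], that is [d (d a)]. *)
  move=> T y; rewrite -cube_diff_edge_bd.
  rewrite (eq_cube_diff _ (g := fun S => d (a^~ y) S)) => [|S]; last by rewrite dac.
  exact: cube_diff_diff.
(* The correction makes [a] a cocycle, as [d] of the boundary of [b1] equals [d a], and it does not
   change classes in [H0]. *)
have [||b0 [b0S db0]] := @vertex_cochain_exact (fun S y => a S y - edge_bd (b1 S) y).
- by move=> S y yS; rewrite aS // (@edge_bd_out S) ?subrr // => k; apply: b1S.
- by move=> T y; rewrite cube_diffB cube_diff_edge_bd b1E dac subrr.
have xb B : x B = cls (val B) (fun y => d (b0^~ y) (val B)).
  rewrite (_ : (fun y => _) = fun y => a (val B) y - edge_bd (b1 (val B)) y).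
    by rewrite clsB -xa cls_edge_bd ?subr0 // => k; apply: b1S.
  by apply/funext => y; apply: db0.
(* In degree 0 only the empty set occurs, where [d b0] is an empty sum; in positive degree the
   classes of [b0] form a primitive of [x]. *)
case: j x dx0 a aS xa daS dac db0 xb => [|j] x dx0 a aS xa daS dac db0 xb.
  apply/eqP/dsumP => B; rewrite xb dsum0E.
  have B0 : val B = set0 by apply: cards0_eq; apply/eqP; apply: (valP B).
  rewrite -(subrr (cls (val B) (fun _ => 0))) -clsB.
  by apply: cls_eq => y _; rewrite subrr B0 /cube_diff big_set0.
apply/imP; exists (dsum_of (fun B : subset_card ladder j => cls (val B) (b0 (val B)))).
apply/dsumP => B; rewrite (@differential_cls _ _ _ _ b0) //.
by move=> C; rewrite dsum_ofE.
Qed.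
End Exactness.
End Ladder.

Theorem corollary5p4 (m : nat) (m_ge3 : (3 <= m)%N)
    (le : rel (cart_prod (path_graph m) (path_graph 2)))
    (le_total : total le) (le_trans : transitive le) (le_anti : antisymmetric le)
    (j : nat) (h : bold_homology le j) :
  h = 0%R.
Proof.
rewrite -[h]reprK -[0](reprK (0 : bold_homology le j)).
apply/eqP; rewrite -Quotient.idealrBE.
(* [z] is the difference of cocycles representing [h] and 0. *)
set z := (X in X \in _).
by apply: cocycle_is_coboundary => //; apply/eqP/(valP z).
Qed.
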